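(* Let $n\ge1$ and let $\Phi^+=\{\widetilde{e}_j-\widetilde{e}_i: i<j,\ i\not\equiv j\bmod n\}$ be the positive root system of type $\widetilde{A}_{n-1}$. For a translationally invariant total order $\prec$ on $\mathbb{Z}$, let $I(\prec)=\{\widetilde{e}_j-\widetilde{e}_i : i<j,\ i\not\equiv j\bmod n,\ i\succ j\}$. Then $I(\prec)$ is biclosed for every such $\prec$, every biclosed subset of $\Phi^+$ equals $I(\prec)$ for some such $\prec$, and $I(\prec_1)=I(\prec_2)$ if and only if $\prec_2$ is obtained from $\prec_1$ by reversing the order on some residue classes $k+n\mathbb{Z}$ that form intervals $\cdots\prec k-n\prec k\prec k+n\prec\cdots$ of the order. That is, biclosed subsets of $\Phi^+$ are in bijection with translationally invariant total orders on $\mathbb{Z}$ modulo reversing such intervals.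
   Context: Let $\widehat V$ be the real vector space spanned by $\widetilde{e}_i$, $i\in\mathbb{Z}$, modulo $\widetilde{e}_{i+n}-\widetilde{e}_i=\widetilde{e}_{j+n}-\widetilde{e}_j$ for all $i,j$. A subset $B\subseteq\Phi^+$ is biclosed if for all $\alpha,\beta,\gamma\in\Phi^+$ with $\gamma\in\mathbb{R}_{>0}\alpha+\mathbb{R}_{>0}\beta$: $\alpha,\beta\in B$ implies $\gamma\in B$, and $\alpha,\beta\notin B$ implies $\gamma\notin B$. A total order $\prec$ on $\mathbb{Z}$ is translationally invariant if $i\prec j \iff i+n\prec j+n$.
   Formalization: The residue classes that may be reversed are those forming intervals of the order in either direction, ascending or descending; with only ascending intervals the ''if and only if'' fails (n=1, first order reversed, second usual). *)

(* Defs.v *)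
From HB Require Import structures.
From mathcomp Require Import all_boot all_order all_algebra.
From mathcomp Require Import boolp classical_sets functions reals.
From mathcomp Require Import freeg.

Set Implicit Arguments.
Unset Strict Implicit.
Unset Printing Implicit Defensive.

Import Order.TTheory GRing.Theory Num.Theory.

Local Open Scope classical_set_scope.
Local Open Scope ring_scope.

Section AffineSpace.
Variables (R : realType) (n : nat).

Definition etilde_free (i : int) : {freeg int / R} := << i >>.

Definition relator (i j : int) : {freeg int / R} :=
  (etilde_free (i + n%:Z) - etilde_free i)
  - (etilde_free (j + n%:Z) - etilde_free j).

(* The linear span of the relators, as a boolean predicate. *)
Definition relators_span : {pred {freeg int / R}} :=
  fun v => `[< exists s : seq (R * (int * int)),
                 v = \sum_(x <- s) x.1 *: relator x.2.1 x.2.2 >].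

Lemma relators_span_submod_closed : submod_closed relators_span.
Proof.
split; first by apply/asboolP; exists [::]; rewrite big_nil.
move=> a u v /asboolP[s ->] /asboolP[t ->]; apply/asboolP.
exists ([seq (a * x.1, x.2) | x <- s] ++ t).
rewrite big_cat big_map /= scaler_sumr; congr (_ + _).
by apply: eq_bigr => x _; rewrite scalerA.
Qed.

HB.instance Definition _ :=
  GRing.isSubmodClosed.Build R {freeg int / R} relators_span
    relators_span_submod_closed.

Let relators_sub := GRing.ZmodClosed.clone {freeg int / R} relators_span _.

Definition Vhat : Type := Quotient.quot relators_sub.
HB.instance Definition _ := GRing.Zmodule.on Vhat.

Definition to_Vhat (v : {freeg int / R}) : Vhat :=
  (\pi_(Quotient.quot relators_sub) v)%qT.

Definition scale_Vhat (a : R) (v : Vhat) : Vhat :=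
  to_Vhat (a *: (repr (v : Quotient.quot relators_sub))%qT).

Lemma to_VhatD : {morph to_Vhat : u v / u + v}.
Proof.
move=> u v.
by rewrite /to_Vhat (raddfD (\pi_(Quotient.quot relators_sub))%qT).
Qed.

Lemma to_Vhat_eq u v : (to_Vhat u = to_Vhat v) <-> (u - v \in relators_span).
Proof. by rewrite Quotient.idealrBE; split=> [/eqP|/eqP]. Qed.

Lemma to_VhatK (v : Vhat) :
  to_Vhat (repr (v : Quotient.quot relators_sub))%qT = v.
Proof. exact: reprK. Qed.

Lemma to_VhatZ a v : to_Vhat (a *: v) = scale_Vhat a (to_Vhat v).
Proof.
apply/to_Vhat_eq; rewrite -scalerBr rpredZ //.
by apply/to_Vhat_eq; rewrite to_VhatK.
Qed.

Lemma scale_VhatA a b v : scale_Vhat a (scale_Vhat b v) = scale_Vhat (a * b) v.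
Proof. by rewrite -[v]to_VhatK -!to_VhatZ scalerA. Qed.

Lemma scale_Vhat1 : left_id 1 scale_Vhat.
Proof. by move=> v; rewrite -[v]to_VhatK -!to_VhatZ scale1r. Qed.

Lemma scale_VhatDr : right_distributive scale_Vhat +%R.
Proof.
move=> a u v; rewrite -[u]to_VhatK -[v]to_VhatK.
by rewrite -to_VhatD -!to_VhatZ -to_VhatD scalerDr.
Qed.

Lemma scale_VhatDl v : {morph scale_Vhat^~ v : a b / a + b}.
Proof.
by move=> a b; rewrite -[v]to_VhatK -!to_VhatZ -to_VhatD scalerDl.
Qed.

HB.instance Definition _ :=
  GRing.Zmodule_isLmodule.Build R Vhat
    scale_VhatA scale_Vhat1 scale_VhatDr scale_VhatDl.

Definition etilde (i : int) : Vhat := to_Vhat (etilde_free i).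

Lemma etilde_relation i j :
  etilde (i + n%:Z) - etilde i = etilde (j + n%:Z) - etilde j.
Proof.
have to_VhatB u v : to_Vhat (u - v) = to_Vhat u - to_Vhat v.
  by apply/(@addIr _ (to_Vhat v)); rewrite -to_VhatD !subrK.
rewrite /etilde -!to_VhatB; apply/to_Vhat_eq/asboolP; exists [:: (1, (i, j))].
by rewrite big_seq1 scale1r.
Qed.

Definition pos_roots : set Vhat :=
  [set r | exists i j : int,
     [/\ i < j, (i != j %[mod n%:Z])%Z & r = etilde j - etilde i]].

Definition biclosed (B : set Vhat) : Prop :=
  B `<=` pos_roots /\
  forall alpha beta gamma : Vhat,
    pos_roots alpha -> pos_roots beta -> pos_roots gamma ->
    (exists a b : R, [/\ 0 < a, 0 < b & gamma = a *: alpha + b *: beta]) ->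
    (B alpha -> B beta -> B gamma) /\ (~ B alpha -> ~ B beta -> ~ B gamma).

(* [lt i j] stands for i ≺ j. *)
Definition inversions (lt : rel int) : set Vhat :=
  [set r | exists i j : int,
     [/\ i < j, (i != j %[mod n%:Z])%Z, lt j i & r = etilde j - etilde i]].

End AffineSpace.

Section InvariantOrders.
Variable n : nat.

(* Total orders are given by their strict relation. *)
Definition strict_total_order (lt : rel int) : Prop :=
  [/\ irreflexive lt, transitive lt & forall i j, i != j -> lt i j || lt j i].

Definition translation_invariant (lt : rel int) : Prop :=
  forall i j, lt i j = lt (i + n%:Z) (j + n%:Z).

Definition invariant_orders : set (rel int) :=
  [set lt | strict_total_order lt /\ translation_invariant lt].

(* The class k + nZ is order-convex.  For an invariant total order it is then
   either ... ≺ k - n ≺ k ≺ k + n ≺ ... or ... ≻ k - n ≻ k ≻ k + n ≻ ..., with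
   nothing in between; both directions are allowed, so that the relation
   [interval_reversal] below is symmetric. *)
Definition class_is_interval (lt : rel int) (k : int) : Prop :=
  forall i x j : int, (i = k %[mod n%:Z])%Z -> (j = k %[mod n%:Z])%Z ->
    lt i x -> lt x j -> (x = k %[mod n%:Z])%Z.

(* Reverse the order on each of the classes k + nZ, k in K. *)
Definition reverse_classes (K : set int) (lt : rel int) : rel int :=
  fun i j =>
    if `[< exists2 k, K k & (i = k %[mod n%:Z])%Z /\ (j = k %[mod n%:Z])%Z >]
    then lt j i else lt i j.

Definition interval_reversal (lt1 lt2 : rel int) : Prop :=
  exists2 K : set int, (forall k, K k -> class_is_interval lt1 k)
    & lt2 = reverse_classes K lt1.

(* The classes of invariant orders modulo [interval_reversal]. *)
Definition invariant_orders_modulo : set (set (rel int)) :=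
  [set C | exists2 lt, invariant_orders lt
         & C = [set lt' | invariant_orders lt' /\ interval_reversal lt lt']].

End InvariantOrders.

Arguments etilde R n i : clear implicits.
Arguments pos_roots R n : clear implicits.
Arguments biclosed {R n} B.
Arguments inversions R n lt : clear implicits.
Arguments invariant_orders n lt : clear implicits.
Arguments interval_reversal n lt1 lt2 : clear implicits.
Arguments invariant_orders_modulo n C : clear implicits.

(* Main.v *)
(** To a relation [lt] attach its descents, the vectors [e j - e i] with [i] and
[j] incongruent mod [n] and [lt j i]: the elements of the inversion set and the
opposites of the other positive roots.  Biclosedness says that no three descents
satisfy a linear relation with positive coefficients (a relation between three
positive roots is excluded by the height [e i |-> i]).

The descents of an invariant order have this property.  The residues turn a
positive relation into a circulation with three edges on the residue classes,
that is, either a 3-cycle with equal weights, which closes up in [int] because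
the heights cancel, or a circulation on two classes, where the descents from [i]
back to its class all point in the direction of that class, so that the heights
cannot cancel.

Conversely, a biclosed set orients each incongruent pair, and the same property
shows that a class cannot be both ascending and descending with respect to the
other elements.  Ordering each class accordingly (ascending if nothing separates
it) yields the required order. *)

From HB Require Import structures.
Require Import Defs.
From mathcomp Require Import all_boot all_order all_algebra.
From mathcomp Require Import boolp classical_sets functions reals.
From mathcomp Require Import freeg zify lra.

Set Implicit Arguments.
Unset Strict Implicit.
Unset Printing Implicit Defensive.

Import Order.TTheory GRing.Theory Num.Theory.

Local Open Scope classical_set_scope.
Local Open Scope ring_scope.

(** * Linear forms on [Vhat] *)

Lemma scalar_sub3 (R : pzRingType) (V : lmodType R) (f : V -> R)
    (a b c : R) (u u' v v' w w' : V) : scalar f ->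
  f (a *: (u - u') + b *: (v - v') + c *: (w - w'))
    = a * (f u - f u') + b * (f v - f v') + c * (f w - f w').
Proof.
move=> fL.
have fB x y : f (x - y) = f x - f y.
  by rewrite addrC -scaleN1r fL mulN1r addrC.
have f0 : f 0 = 0 by rewrite -[0](subrr 0) fB subrr.
have fZ k x : f (k *: x) = k * f x by rewrite -[k *: x]addr0 fL f0 addr0.
by rewrite -addrA !fL fZ !fB addrA.
Qed.

Section Forms.
Variables (R : realType) (n : nat).
Local Notation e := (etilde R n).

Lemma freeg_form (g : int -> R) :
  exists2 f : {freeg int / R} -> R, scalar f
    & forall i, f (etilde_free R i) = g i.
Proof.
pose F (D : {freeg int / R}) : R := fglift (g : int -> R^o) D.
pose FA := GRing.isAdditive.Build _ _ F (@lift_is_additive _ _ R^o g).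
pose Fa : {additive {freeg int / R} -> R} := HB.pack F FA.
have FaU k x : Fa << k *g x >> = k * g x by exact: (@liftU R R^o _ g).
exists F => [c D D' | i]; last by rewrite -[LHS]/(Fa _) FaU mul1r.
rewrite -[LHS]/(Fa _) raddfD; congr (_ + _).
(* Additivity comes with [fglift]; compatibility with scalars is checked term by term on the
   generators. *)
rewrite -[F D]/(Fa D) -[D in RHS]freeg_sumE.
rewrite [c *: D](_ : _ = fgscale c D) // !raddf_sum mulr_sumr.
by apply: eq_bigr => x _; rewrite !FaU mulrA.
Qed.

(** The linear extension of [g] sends both differences in a relator to [d], hence kills the relators
    and factors through the quotient. Such forms serve to test linear relations in [Vhat]. *)
Lemma Vhat_form (g : int -> R) (d : R) :
    (forall i, g (i + n%:Z) = g i + d) ->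
  exists2 f : Vhat R n -> R, scalar f & forall i, f (e i) = g i.
Proof.
move=> g_step; have [f fL fE] := freeg_form g.
have fB u v : f (u - v) = f u - f v.
  by rewrite addrC -scaleN1r fL mulN1r addrC.
have f0 : f 0 = 0 by rewrite -[0](subrr 0) fB subrr.
pose F (v : Vhat R n) : R := f (repr (v : Quotient.quot _))%qT.
have f_rel v : v \in @relators_span R n -> f v = 0.
  case/asboolP => s ->; elim: s => [|x s IHs]; first by rewrite big_nil.
  rewrite big_cons fL {}IHs /relator !fB !fE !g_step; lra.
have FE v : F (to_Vhat n v) = f v.
  apply/eqP; rewrite -subr_eq0 -fB f_rel //.
  by apply/to_Vhat_eq; rewrite to_VhatK.
exists F => [a u v | i]; last by rewrite FE fE.
rewrite -[u]to_VhatK -[v]to_VhatK !FE -fL -FE to_VhatD.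
by congr (F (_ + _)); rewrite to_VhatZ.
Qed.

Lemma form_relation3 (g : int -> R) (d a b c : R) (i1 j1 i2 j2 i3 j3 : int) :
    (forall i, g (i + n%:Z) = g i + d) ->
    a *: (e j1 - e i1) + b *: (e j2 - e i2) + c *: (e j3 - e i3) = 0 ->
  a * (g j1 - g i1) + b * (g j2 - g i2) + c * (g j3 - g i3) = 0.
Proof.
move=> /Vhat_form[f fL fE] rel0.
rewrite -!fE -(scalar_sub3 _ _ _ _ _ _ _ _ _ fL) rel0.
have := scalar_sub3 0 0 0 (e 0) 0 0 0 0 0 fL.
by rewrite !scale0r !addr0 !mul0r !addr0.
Qed.

Lemma etilde_shift (i m : int) :
  e (i + m * n%:Z) = e i + m%:~R *: (e n%:Z - e 0).
Proof.
have step j : e (j + n%:Z) = e j + (e n%:Z - e 0).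
  have := etilde_relation R n j 0; rewrite add0r => <-.
  by rewrite [RHS]addrC subrK.
(* [D] is the null root: moving any index by one period adds this same vector. *)
set D := e n%:Z - e 0 in step *.
have scaleS k : (k + 1)%:~R *: D = k%:~R *: D + D.
  by rewrite intrD mulr1z scalerDl scale1r.
elim: m => [|m IHm|m IHm]; first by rewrite mul0r scale0r !addr0.
  rewrite (_ : i + _ = i + m%:Z * n%:Z + n%:Z); last lia.
  by rewrite step IHm -addn1 PoszD scaleS -addrA.
apply: (addIr D); rewrite -step.
rewrite (_ : i + _ + _ = i + - m%:Z * n%:Z); last lia.
by rewrite IHm -addrA -scaleS; congr (_ + _%:~R *: _); lia.
Qed.

End Forms.

Lemma eqz_modP (d i j : int) :
  reflect (exists m, j = i + m * d) (i == j %[mod d])%Z.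
Proof.
rewrite eq_sym eqz_mod_dvd; apply: (iffP dvdzP) => -[m ij]; exists m.
  by rewrite -ij addrC subrK.
by rewrite ij addrC addKr.
Qed.

(** * Circulations with three weighted edges *)

Section Circulation.
Variables (R : realFieldType) (T : eqType).

(** The first edge brings weight [a > 0] into [j1], which only an edge leaving [j1] can cancel;
    dually at [i1]. *)
Lemma circulation_ends (i1 j1 i2 j2 i3 j3 : T) (a b c : R) :
  0 < a -> 0 < b -> 0 < c -> i1 != j1 ->
  (forall r, a * ((j1 == r)%:R - (i1 == r)%:R)
             + b * ((j2 == r)%:R - (i2 == r)%:R)
             + c * ((j3 == r)%:R - (i3 == r)%:R) = 0) ->
  (j1 = i2 \/ j1 = i3) /\ (i1 = j2 \/ i1 = j3).
Proof.
move=> a0 b0 c0 d1 circ; split.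
  move: (circ j1); rewrite eqxx (negPf d1).
  have [->|_] := eqVneq i2 j1; first by left.
  have [->|_] := eqVneq i3 j1; first by right.
  by case: (j2 == j1) (j3 == j1) => [] [] /= H; exfalso; lra.
move: (circ i1); rewrite eqxx eq_sym (negPf d1).
have [->|_] := eqVneq j2 i1; first by left.
have [->|_] := eqVneq j3 i1; first by right.
by case: (i2 == i1) (i3 == i1) => [] [] /= H; exfalso; lra.
Qed.

(* The last three cases are the circulations between two vertices. *)
Lemma circulation3 (i1 j1 i2 j2 i3 j3 : T) (a b c : R) :
  0 < a -> 0 < b -> 0 < c -> i1 != j1 -> i2 != j2 -> i3 != j3 ->
  (forall r, a * ((j1 == r)%:R - (i1 == r)%:R)
             + b * ((j2 == r)%:R - (i2 == r)%:R)
             + c * ((j3 == r)%:R - (i3 == r)%:R) = 0) ->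
  ([/\ j1 = i2, j2 = i3, j3 = i1, a = b & b = c] \/
   [/\ j1 = i3, j3 = i2, j2 = i1, a = b & b = c]) \/
  [\/ [/\ i2 = i3, j2 = j3, i1 = j2, j1 = i2 & a = b + c],
      [/\ i1 = i3, j1 = j3, i2 = j1, j2 = i1 & b = a + c]
    | [/\ i1 = i2, j1 = j2, i3 = j1, j3 = i1 & c = a + b]].
Proof.
move=> a0 b0 c0 d1 d2 d3 circ.
have [E1 E2] := circulation_ends a0 b0 c0 d1 circ.
have [E3 E4] : (j2 = i1 \/ j2 = i3) /\ (i2 = j1 \/ i2 = j3).
  by apply: (circulation_ends b0 a0 c0 d2) => r; have := circ r; lra.
have [E5 E6] : (j3 = i1 \/ j3 = i2) /\ (i3 = j1 \/ i3 = j2).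
  by apply: (circulation_ends c0 a0 b0 d3) => r; have := circ r; lra.
(* For each pattern of incidences, the balance at these four vertices yields the equations between
   the weights or a contradiction. *)
move: (circ i1) (circ j1) (circ i2) (circ j2) d1 d2 d3.
case: E1 E2 E3 E4 E5 E6 {circ} => [?|?] [?|?] [?|?] [?|?] [?|?] [?|?]; subst;
  rewrite ?eqxx //= => + + + + d1 d2 d3;
  rewrite ?(negPf d1) ?(negPf d2) ?(negPf d3);
  rewrite 1?[_ == _]eq_sym ?(negPf d1) ?(negPf d2) ?(negPf d3);
  rewrite 1?[_ == _]eq_sym ?(negPf d1) ?(negPf d2) ?(negPf d3) /=;
  move=> h1 h2 h3 h4;
  (* An open goal between vertices marks a wrong alternative, so only goals about weights go to
     [lra]. *)
  let arith := (idtac; lazymatch goal with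
    | |- @eq (Equality.sort _) _ _ => fail
    | _ => clear -h1 h2 h3 h4; lra
    end) in
  solve [left; left; split=> //; arith
    |left; right; split=> //; arith
    |right; apply: Or31; split=> //; arith
    |right; apply: Or32; split=> //; arith
    |right; apply: Or33; split=> //; arith
    |exfalso; clear -a0 b0 c0 h1 h2 h3 h4; lra].
Qed.

End Circulation.

(** * Residue classes and cycles in an invariant order *)

Lemma shift_invariant (n : nat) (lt : rel int) : translation_invariant n lt ->
  forall m i j : int, lt (i + m * n%:Z) (j + m * n%:Z) = lt i j.
Proof.
move=> inv m i j; elim: m => [|m IHm|m IHm]; first by rewrite !mul0r !addr0.
  by rewrite -IHm [RHS]inv; congr (lt _ _); lia.
by rewrite -IHm [LHS]inv; congr (lt _ _); lia.
Qed.

Section InvariantOrderFacts.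
Variables (n : nat) (lt : rel int).
Hypotheses (n_gt0 : (0 < n)%N) (lt_ord : invariant_orders n lt).

Lemma ord_asym i j : lt i j -> lt j i -> False.
Proof. by case: lt_ord => -[irr tr _] _ /tr h /h; rewrite irr. Qed.

Lemma ord_total i j : i != j -> ~~ lt i j -> lt j i.
Proof. by case: lt_ord => -[_ _ tot] _ /tot /orP[->|]. Qed.

Let ord_shift := shift_invariant lt_ord.2.

(** Chaining the translates of one comparison between [k] and [k + n] orders the whole class in a
    single direction. *)
Lemma ord_class (i j : int) : (i == j %[mod n%:Z])%Z ->
  lt i j = if i < j then lt i (i + n%:Z) else (j < i) && lt (i + n%:Z) i.
Proof.
have [[irr tr tot] inv] := lt_ord.
have up k (m : nat) : lt k (k + n%:Z) -> lt k (k + m.+1%:Z * n%:Z).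
  move=> k_up; elim: m => [|m IHm]; first by rewrite mul1r.
  apply: tr IHm _; rewrite -(ord_shift m.+1%:Z) in k_up.
  by congr (lt _ _): k_up; lia.
have down k (m : nat) : lt (k + n%:Z) k -> lt (k + m.+1%:Z * n%:Z) k.
  move=> k_down; elim: m => [|m IHm]; first by rewrite mul1r.
  apply: tr IHm; rewrite -(ord_shift m.+1%:Z) in k_down.
  by congr (lt _ _): k_down; lia.
have nn0 k : k != k + n%:Z by lia.
case/eqz_modP => -[[|m]|m] ->; first by rewrite mul0r addr0 ltxx irr.
  have -> : i < i + m.+1%:Z * n%:Z by lia.
  apply/idP/idP; last exact: up.
  apply: contraTT => /(ord_total (nn0 i))/down lt_m; apply/negP.
  by move/ord_asym; apply.
have [-> ->] : (i < i + Negz m * n%:Z) = false /\ i + Negz m * n%:Z < i by lia.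
(* For a negative displacement the smaller element is named [k], so that [up] and [down] apply from
   it. *)
have [k ik kE] : exists2 k, i = k + m.+1%:Z * n%:Z & i + Negz m * n%:Z = k.
  by exists (i + Negz m * n%:Z) => //; lia.
rewrite kE {}ik {kE}.
rewrite addrAC ord_shift /=; apply/idP/idP; last exact: down.
apply: contraTT => /negP kn.
have /up lt_m : lt k (k + n%:Z).
  by apply: ord_total; [rewrite eq_sym | apply/negP].
by apply/negP => /(ord_asym (lt_m m)).
Qed.

Lemma ord_classE (i j k : int) :
    (i = k %[mod n%:Z])%Z -> (j = k %[mod n%:Z])%Z ->
  lt i j = (i != j) && ((i < j) == lt k (k + n%:Z)).
Proof.
move=> /eqP ik /eqP jk; rewrite ord_class; last by rewrite (eqP ik) eq_sym.
have [m ->] := eqz_modP _ _ _ ik; rewrite (addrAC i) ord_shift.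
have -> : lt (i + n%:Z) i = ~~ lt i (i + n%:Z).
  apply/idP/idP => [h|]; last by apply: ord_total; lia.
  by apply/negP => /(ord_asym h).
by case: (ltgtP i j) => //=; case: (lt i _).
Qed.

Lemma ord_class_direction (i s t : int) :
  lt (i + s * n%:Z) i -> lt (i + t * n%:Z) i -> 0 < s * t.
Proof.
have E m : lt (i + m * n%:Z) i =
    if m < 0 then lt i (i + n%:Z) else (0 < m) && lt (i + n%:Z) i.
  rewrite ord_class; last by rewrite addrC modzMDl.
  rewrite addrAC !ord_shift.
  have -> : (i + m * n%:Z < i) = (m < 0) by nia.
  by have -> : (i < i + m * n%:Z) = (0 < m) by nia.
rewrite !E; have asym := @ord_asym i (i + n%:Z).
case: (ltgtP s 0) (ltgtP t 0) => [s0|s0|s0] [t0|t0|t0] //=; nia.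
Qed.

(** Translates of the three comparisons join head to tail; the vanishing sum makes the chain return
    to [i1] itself, not merely to its class. *)
Lemma no_three_cycle (i1 j1 i2 j2 i3 j3 : int) :
    lt j1 i1 -> lt j2 i2 -> lt j3 i3 ->
    (j1 == i2 %[mod n%:Z])%Z -> (j2 == i3 %[mod n%:Z])%Z ->
    (j1 - i1) + (j2 - i2) + (j3 - i3) = 0 ->
  False.
Proof.
move=> lt1 lt2 lt3 /eqz_modP[m i2E] /eqz_modP[s i3E]; subst i2 i3 => sum0.
move: lt2 lt3; rewrite -(ord_shift (- m) j2) -(ord_shift (- m - s) j3).
move=> lt2 lt3.
have [irr tr _] := lt_ord.1; suff : lt i1 i1 by rewrite irr.
apply: (tr _ _ _ _ lt1); apply: (tr (j2 + - m * n%:Z)); last first.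
  by congr (lt _ _): lt2; lia.
by congr (lt _ _): lt3; lia.
Qed.

(** A translate of the second comparison leads from the class of [j1] back to that of [i1]. Composed
    with the first and with the third, it displaces [i1] by [q - p] and by [q - p + s - m] periods.
    Both displacements have the same sign, yet the heights make their combination with weights [a]
    and [b] vanish. *)
Lemma no_two_class_circulation (R : realFieldType) (a b : R)
    (i1 j1 i2 j2 i3 j3 : int) :
    0 < a -> 0 < b -> lt j1 i1 -> lt j2 i2 -> lt j3 i3 ->
    (i1 == i3 %[mod n%:Z])%Z -> (j1 == j3 %[mod n%:Z])%Z ->
    (j1 == i2 %[mod n%:Z])%Z -> (i1 == j2 %[mod n%:Z])%Z ->
    a * (j1%:~R - i1%:~R) + (a + b) * (j2%:~R - i2%:~R)
      + b * (j3%:~R - i3%:~R) = 0 ->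
  False.
Proof.
move=> a0 b0 lt1 lt2 lt3 /eqz_modP[m i3E] /eqz_modP[s j3E] /eqz_modP[p i2E].
case/eqz_modP => q j2E; subst i2 i3 j2 j3; move: lt2 lt3.
rewrite -(ord_shift (- p) _ (j1 + _)) -(ord_shift (- m) _ (i1 + _)).
move=> lt2 lt3 sum0.
have [irr tr _] := lt_ord.1.
have down1 : lt (i1 + (q - p) * n%:Z) i1.
  by apply: (tr _ _ _ _ lt1); congr (lt _ _): lt2; lia.
have down3 : lt (i1 + (q - p + s - m) * n%:Z) i1.
  apply: (tr (j1 + (s - m) * n%:Z)); last by congr (lt _ _): lt3; lia.
  by rewrite -(ord_shift (m - s)); congr (lt _ _): lt2; lia.
have := ord_class_direction down1 down3.
have {}sum0 : a * (q - p)%:~R + b * (q - p + s - m)%:~R = 0 :> R.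
  have n0 : n%:R != 0 :> R by rewrite pnatr_eq0 -lt0n.
  apply: (mulIf n0); rewrite mul0r -sum0 !(intrD, intrM, intrN, rmorphB) /=.
  lra.
move: (q - p) (q - p + s - m) sum0 => x y; rewrite -(ltr0z R) rmorphM /=.
move: (x%:~R : R) (y%:~R : R) => {}x {}y sum0 xy0.
(* After multiplication by [x] the first term is nonnegative and the second positive. *)
have : a * x ^+ 2 + b * (x * y) = 0.
  by rewrite expr2 !(mulrCA _ x) -mulrDr sum0 mulr0.
apply/eqP; rewrite gt_eqF // ltr_wpDl //; last exact: mulr_gt0.
by rewrite mulr_ge0 ?sqr_ge0 // ltW.
Qed.

End InvariantOrderFacts.

(** * Descents and inversion sets of invariant orders *)

Section Descents.
Variables (R : realType) (n : nat).
Local Notation e := (etilde R n).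
Implicit Types (lt : rel int) (u v w : Vhat R n) (a b c : R).

Definition descent lt : set (Vhat R n) :=
  [set v | exists i j, [/\ (i != j %[mod n%:Z])%Z, lt j i & v = e j - e i]].

Definition no_positive_relation lt := forall u v w a b c,
  descent lt u -> descent lt v -> descent lt w ->
  0 < a -> 0 < b -> 0 < c -> a *: u + b *: v + c *: w <> 0.

Lemma order_no_positive_relation lt : (0 < n)%N ->
  invariant_orders n lt -> no_positive_relation lt.
Proof.
move=> n_gt0 lt_ord u v w a b c [i1 [j1 [d1 lt1 ->]]] [i2 [j2 [d2 lt2 ->]]].
move=> [i3 [j3 [d3 lt3 ->]]] a0 b0 c0 rel0.
(* The indicator of a residue class is [n]-periodic, hence a form with [d = 0]; it turns the
   relation into a circulation on residues. *)
have circ r : a * (((j1 %% n)%Z == r)%:R - ((i1 %% n)%Z == r)%:R)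
    + b * (((j2 %% n)%Z == r)%:R - ((i2 %% n)%Z == r)%:R)
    + c * (((j3 %% n)%Z == r)%:R - ((i3 %% n)%Z == r)%:R) = 0.
  apply: (form_relation3 (g := fun i => ((i %% n)%Z == r)%:R) (d := 0) _ rel0).
  by move=> i; rewrite modzDr addr0.
have height : a * (j1%:~R - i1%:~R) + b * (j2%:~R - i2%:~R)
    + c * (j3%:~R - i3%:~R) = 0.
  by apply: (form_relation3 (d := n%:R) _ rel0) => i; rewrite intrD.
have sum0 : a = b -> b = c -> (j1 - i1) + (j2 - i2) + (j3 - i3) = 0.
  move=> ab bc; apply/eqP; rewrite -(intr_eq0 R) !(intrD, rmorphB) /=.
  apply/eqP; apply: (mulfI (lt0r_neq0 a0)); rewrite mulr0 -height -bc -ab; lra.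
have := circulation3 a0 b0 c0 d1 d2 d3 circ.
case=> [[[/eqP E1 /eqP E2 E3 ab bc]|[/eqP E1 /eqP E2 E3 ab bc]]|].
- by apply: (no_three_cycle n_gt0 lt_ord lt1 lt2 lt3 E1 E2); exact: sum0.
- apply: (no_three_cycle n_gt0 lt_ord lt1 lt3 lt2 E1 E2).
  by have := sum0 ab bc; lia.
(* On two classes, one edge runs against the other two and carries the sum of their weights; it is
   passed as the middle comparison. *)
case=> [[E1 E2 E3 E4 ab]|[E1 E2 E3 E4 ab]|[E1 E2 E3 E4 ab]].
- apply: (no_two_class_circulation n_gt0 lt_ord b0 c0 lt2 lt1 lt3);
    try by apply/eqP; congruence.
  by rewrite -ab; lra.
- apply: (no_two_class_circulation n_gt0 lt_ord a0 c0 lt1 lt2 lt3);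
    try by apply/eqP; congruence.
  by rewrite -ab; lra.
- apply: (no_two_class_circulation n_gt0 lt_ord a0 b0 lt1 lt3 lt2);
    try by apply/eqP; congruence.
  by rewrite -ab; lra.
Qed.

Lemma descent_etilde lt (i j : int) :
  (i != j %[mod n%:Z])%Z -> lt j i -> descent lt (e j - e i).
Proof. by move=> ij ltji; exists i, j. Qed.

Lemma descent_opp lt v : no_positive_relation lt ->
  descent lt v -> descent lt (- v) -> False.
Proof.
move=> npr dv dNv; apply: (npr v v (- v) 1 1 2 dv dv dNv) => //.
by rewrite scalerN scaler_nat !scale1r -mulr2n subrr.
Qed.

Lemma descent_flip lt v : descent (fun i j => lt j i) v -> descent lt (- v).
Proof.
by case=> i [j [ij ltij ->]]; exists j, i; split=> //; rewrite ?opprB // eq_sym.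
Qed.

Lemma no_positive_relation_flip lt :
  no_positive_relation lt -> no_positive_relation (fun i j => lt j i).
Proof.
move=> npr u v w a b c /descent_flip du /descent_flip dv /descent_flip dw.
move=> a0 b0 c0 rel0; apply: (npr _ _ _ _ _ _ du dv dw a0 b0 c0).
by rewrite !scalerN -!opprD rel0 oppr0.
Qed.

Lemma inversion_descent lt v : inversions R n lt v -> descent lt v.
Proof. by case=> i [j [_ ij ltji ->]]; exists i, j. Qed.

Lemma noninversion_descent lt v : invariant_orders n lt ->
  pos_roots R n v -> ~ inversions R n lt v -> descent lt (- v).
Proof.
move=> lt_ord [i [j [lt_ij ij ->]]] ninv; rewrite opprB.
apply: descent_etilde; first by rewrite eq_sym.
apply: (ord_total lt_ord); first by rewrite gt_eqF.
by apply/negP => ltji; apply: ninv; exists i, j.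
Qed.

(** A violation at [w = a u + b v] would make [u], [v], [- w], or their opposites, three descents
    with a positive relation. *)
Lemma inversions_biclosed lt : (0 < n)%N ->
  invariant_orders n lt -> biclosed (inversions R n lt).
Proof.
move=> n_gt0 lt_ord; have npr := order_no_positive_relation n_gt0 lt_ord.
split=> [v [i [j [lt_ij ij _ ->]]]|]; first by exists i, j.
move=> u v w pu pv pw [a [b [a0 b0 wE]]]; split.
  move=> /inversion_descent du /inversion_descent dv; apply: contrapT.
  move=> /(noninversion_descent lt_ord pw) dw.
  by apply: (npr _ _ _ a b 1 du dv dw) => //; rewrite scale1r wE subrr.
move=> /(noninversion_descent lt_ord pu) du.
move=> /(noninversion_descent lt_ord pv) dv /inversion_descent dw.
apply: (npr _ _ _ a b 1 du dv dw) => //.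
by rewrite scale1r !scalerN -opprD -wE addNr.
Qed.

(** An inversion is known only as a vector and may come from another pair of indices. The pair need
    not be recovered: a disagreement at [i], [j] would make a vector and its opposite descents of
    one order. *)
Lemma eq_inversions lt1 lt2 (i j : int) : (0 < n)%N ->
    invariant_orders n lt1 -> invariant_orders n lt2 ->
    inversions R n lt1 = inversions R n lt2 ->
  (i != j %[mod n%:Z])%Z -> lt1 i j = lt2 i j.
Proof.
move=> n_gt0 ord1 ord2 eqI ij.
have half lt lt' : invariant_orders n lt -> invariant_orders n lt' ->
    inversions R n lt = inversions R n lt' -> lt i j -> lt' i j.
  move=> ord ord' eqI' ltij; apply: contraT => nltij.
  have neq_ij : i != j by apply: contraNneq ij => ->.
  have ltji := ord_total ord' neq_ij nltij.
  have [neq_lt|neq_lt|eq_ij] := ltgtP i j; last by rewrite eq_ij eqxx in neq_ij.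
    exfalso; have npr := order_no_positive_relation n_gt0 ord.
    apply: (descent_opp npr (v := e j - e i)); last first.
      by rewrite opprB; apply: descent_etilde => //; rewrite eq_sym.
    by apply: inversion_descent; rewrite eqI'; exists i, j.
  exfalso; have npr := order_no_positive_relation n_gt0 ord'.
  apply: (descent_opp npr (v := e i - e j)); last first.
    by rewrite opprB; apply: descent_etilde.
  apply: inversion_descent; rewrite -eqI'; exists j, i.
  by split=> //; rewrite eq_sym.
by apply/idP/idP; apply: half.
Qed.

Lemma eq_inversions_reversal lt1 lt2 : (0 < n)%N ->
    invariant_orders n lt1 -> invariant_orders n lt2 ->
  inversions R n lt1 = inversions R n lt2 <-> interval_reversal n lt1 lt2.
Proof.
move=> n_gt0 ord1 ord2; split=> [eqI|[K _ ->]]; last first.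
  have agree (i j : int) : (i != j %[mod n%:Z])%Z ->
      reverse_classes n K lt1 j i = lt1 j i.
    move=> /eqP ij; rewrite /reverse_classes.
    case: asboolP => // -[k _ [jk ik]].
    by case: ij; rewrite ik.
  by apply/seteqP; split=> v [i [j [lt_ij ij ltji ->]]]; exists i, j;
    split=> //; move: ltji; rewrite agree.
have agree i j := @eq_inversions _ _ i j n_gt0 ord1 ord2 eqI.
(* The classes to reverse are those on which the two orders run in opposite directions. *)
exists [set k | lt1 k (k + n%:Z) != lt2 k (k + n%:Z)].
  (* An [x] outside the class lying between [i] and [j] compares with them alike in both orders,
     which would force the same direction on the class. *)
  move=> k /= dir i x j ik jk ltix ltxj; apply/eqP; apply: contraT => xk.
  have lt1ij : lt1 i j by have [_ tr _] := ord1.1; apply: tr ltix ltxj.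
  have lt2ij : lt2 i j.
    have [_ tr _] := ord2.1; apply: (tr x); rewrite -agree //.
      by rewrite ik eq_sym.
    by rewrite jk.
  move: lt1ij lt2ij dir.
  rewrite (ord_classE n_gt0 ord1 ik jk) (ord_classE n_gt0 ord2 ik jk).
  by move=> /andP[_ /eqP <-] /andP[_ /eqP <-]; rewrite eqxx.
apply/funext => i; apply/funext => j; rewrite /reverse_classes; case: asboolP.
  move=> [k dir [ik jk]]; rewrite (ord_classE n_gt0 ord1 jk ik).
  rewrite (ord_classE n_gt0 ord2 ik jk) (eq_sym j).
  case: (ltgtP i j) dir => //= _;
    by case: (lt1 k _) (lt2 k _) => [] [].
move=> nK; have [/eqP ij|ij] := boolP (i == j %[mod n%:Z])%Z; last first.
  by rewrite agree.
rewrite (ord_classE n_gt0 ord1 ij erefl) (ord_classE n_gt0 ord2 ij erefl).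
suff -> : lt1 j (j + n%:Z) = lt2 j (j + n%:Z) by [].
by apply/eqP; apply: contra_notT nK => dir; exists j.
Qed.

(** * The tournament attached to a biclosed set *)

Lemma biclosed_tournament (B : set (Vhat R n)) : biclosed B ->
  exists t : rel int, [/\ translation_invariant n t,
    forall i j : int, (i != j %[mod n%:Z])%Z -> t i j = ~~ t j i,
    no_positive_relation t
  & B = inversions R n t].
Proof.
move=> [Bpos Bcl].
(* [t i j] is meant as [i ≺ j]: an incongruent pair is inverted exactly when its positive root lies
   in [B]. *)
pose t : rel int := fun i j =>
  `[< if i < j then ~ B (e j - e i) else B (e i - e j) >].
have signed v : descent t v ->
    pos_roots R n v /\ B v \/ pos_roots R n (- v) /\ ~ B (- v).
  case=> i [j [ij /asboolP + ->]]; case: ifPn => [ltji nB|].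
    right; rewrite opprB; split=> //; exists j, i; split=> //.
    by rewrite eq_sym.
  rewrite -leNgt le_eqVlt => /orP[/eqP eq_ij|ltij].
    by rewrite eq_ij eqxx in ij.
  by move=> Bv; left; split=> //; exists i, j.
have solve3 u v w a b c : 0 < c -> a *: u + b *: v + c *: w = 0 ->
    - w = (a / c) *: u + (b / c) *: v.
  move=> c0 /eqP; rewrite addr_eq0 => /eqP E.
  rewrite ![_ / c]mulrC -!scalerA -scalerDr E scalerN scalerA mulVf ?scale1r //.
  exact: lt0r_neq0.
have two_pos u v w a b c : pos_roots R n u -> B u -> pos_roots R n v -> B v ->
    pos_roots R n (- w) -> ~ B (- w) -> 0 < a -> 0 < b -> 0 < c ->
    a *: u + b *: v + c *: w <> 0.
  move=> pu Bu pv Bv pw nBw a0 b0 c0 rel0; apply: nBw.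
  have [//|+ _] := Bcl _ _ _ pu pv pw; last exact.
  exists (a / c), (b / c); rewrite !divr_gt0 //; split=> //.
  exact: solve3 c0 rel0.
have two_neg u v w a b c : pos_roots R n (- u) -> ~ B (- u) ->
    pos_roots R n (- v) -> ~ B (- v) ->
    pos_roots R n w -> B w -> 0 < a -> 0 < b -> 0 < c ->
    a *: u + b *: v + c *: w <> 0.
  move=> pu nBu pv nBv pw Bw a0 b0 c0 rel0.
  have [//|_ +] := Bcl _ _ _ pu pv pw; last exact.
  exists (a / c), (b / c); rewrite !divr_gt0 //; split=> //.
  by rewrite !scalerN -opprD -(solve3 _ _ _ _ _ _ c0 rel0) opprK.
have all_pos u v w a b c :
    pos_roots R n u -> pos_roots R n v -> pos_roots R n w ->
    0 < a -> 0 < b -> 0 < c -> a *: u + b *: v + c *: w <> 0.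
  move=> [i1 [j1 [lt1 _ ->]]] [i2 [j2 [lt2 _ ->]]] [i3 [j3 [lt3 _ ->]]].
  move=> a0 b0 c0 /(form_relation3 (g := intr) (d := n%:R)) height.
  have := height (fun i => intrD _ _ _); apply/eqP; rewrite gt_eqF //.
  by rewrite !addr_gt0 // mulr_gt0 // subr_gt0 ltr_int.
exists t; split.
- move=> i j; rewrite /t ltrD2r; congr `[< _ >].
  have shift k l : e (k + n%:Z) - e (l + n%:Z) = e k - e l.
    apply/eqP; rewrite subr_eq addrAC -subr_eq opprK addrC -subr_eq addrAC.
    by rewrite (etilde_relation R n k l) subrK.
  by rewrite !shift.
- move=> i j ij; rewrite -asbool_neg; apply/asbool_equiv_eq.
  have [ltij|ltji|eq_ij] := ltgtP i j; last by rewrite eq_ij eqxx in ij.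
    by split.
  by split=> [Bv|/contrapT //]; apply.
- move=> u v w a b c /signed su /signed sv /signed sw a0 b0 c0 rel0.
  (* The terms are permuted so that, when the signs differ, the vector with the odd sign comes
     last. *)
  have rel1 : a *: u + c *: w + b *: v = 0 by rewrite addrAC.
  have rel2 : b *: v + c *: w + a *: u = 0 by rewrite addrC addrA.
  case: su sv sw => [[pu Bu]|[pu Bu]] [[pv Bv]|[pv Bv]] [[pw Bw]|[pw Bw]].
  + exact: all_pos rel0.
  + exact: two_pos rel0.
  + exact: two_pos rel1.
  + exact: two_neg rel2.
  + exact: two_pos rel2.
  + exact: two_neg rel1.
  + exact: two_neg rel0.
  + apply: (all_pos (- u) (- v) (- w) a b c) => //.
    by rewrite !scalerN -!opprD rel0 oppr0.
- apply/seteqP; split=> [v Bv|v [i [j [ltij ij tji ->]]]].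
    have [i [j [ltij ij vE]]] := Bpos v Bv; exists i, j; split=> //.
    by apply/asboolP; rewrite ltNge (ltW ltij) /= -vE.
  by move/asboolP: tji; rewrite ltNge (ltW ltij).
Qed.

(** * From a tournament to an invariant order *)

Section TournamentToOrder.
Variable t : rel int.
Hypotheses (n_gt0 : (0 < n)%N) (t_inv : translation_invariant n t).
Hypothesis t_total : forall i j : int,
  (i != j %[mod n%:Z])%Z -> t i j = ~~ t j i.
Hypothesis t_npr : no_positive_relation t.

Lemma tournament_trans (i j k : int) :
    (i != j %[mod n%:Z])%Z -> (j != k %[mod n%:Z])%Z ->
    (i != k %[mod n%:Z])%Z ->
  t i j -> t j k -> t i k.
Proof.
move=> ij jk ik tij tjk; rewrite t_total //; apply/negP => tki.
have := @t_npr (e i - e j) (e j - e k) (e k - e i) 1 1 1.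
rewrite !scale1r !subrKA subrr; apply=> //;
  by apply: descent_etilde => //; rewrite eq_sym.
Qed.

(* Excluding this pattern for [t] and for its converse makes the elements of a
   class that lie below [x] an initial or a final segment of the class. *)
Lemma tournament_class_convex (r : rel int) (p q s x : int) :
    no_positive_relation r ->
    (q = p %[mod n%:Z])%Z -> (s = p %[mod n%:Z])%Z -> (x != p %[mod n%:Z])%Z ->
  p < q -> q < s -> r p x -> r x q -> r s x -> False.
Proof.
move=> npr qp sp xp pq qs rpx rxq rsx.
have [m qE] := eqz_modP _ _ _ (introT eqP (esym qp)).
have [l sE] := eqz_modP _ _ _ (introT eqP (esym sp)).
have [m0 ml] : 0 < m /\ m < l by nia.
(* Since [q] and [s] lie [m] and [l] periods above [p], [l] times [e q] is [l - m] times [e p] plus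
   [m] times [e s]; the multiples of [e x] cancel too. *)
apply: (npr (e p - e x) (e x - e q) (e s - e x) (l - m)%:~R l%:~R m%:~R);
  rewrite ?ltr0z ?subr_gt0 ?(lt_trans m0 ml) //.
- exact: descent_etilde.
- by apply: descent_etilde; rewrite // qp eq_sym.
- by apply: descent_etilde; rewrite // sp.
rewrite -(opprB (e q)) qE sE !etilde_shift ![e p + _ - e x]addrAC.
move: (e p - e x) (e n%:Z - e 0) => P D.
rewrite rmorphB /= scalerBl scalerN !scalerDr !scalerA (mulrC m%:~R) opprD.
by rewrite [X in X + _]addrACA subrr add0r -opprD addNr.
Qed.

(** Here [x] makes the class of [p] ascend and [y] makes it descend. The comparison of [x] with [y]
    carries one separation over to the other, where convexity refutes it. *)
Lemma tournament_class_oriented (p q p' q' x y : int) :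
    (q = p %[mod n%:Z])%Z -> (p' = p %[mod n%:Z])%Z -> (q' = p %[mod n%:Z])%Z ->
    (x != p %[mod n%:Z])%Z -> (y != p %[mod n%:Z])%Z ->
  p < q -> t p x -> t x q -> p' < q' -> t y p' -> t q' y -> False.
Proof.
move=> qp pp qq xp yp pq tpx txq pq' typ tqy.
have asym i j : (i != j %[mod n%:Z])%Z -> t i j -> t j i -> False.
  by move=> ij; rewrite t_total // => /negP.
have convex1 k l m z : (k = p %[mod n%:Z])%Z -> (l = p %[mod n%:Z])%Z ->
    (m = p %[mod n%:Z])%Z -> (z != p %[mod n%:Z])%Z -> k < l -> l < m ->
    t k z -> t z l -> t m z -> False.
  move=> kp lp mp zp; apply: (tournament_class_convex t_npr);
    by rewrite ?kp ?lp ?mp.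
have convex2 k l m z : (k = p %[mod n%:Z])%Z -> (l = p %[mod n%:Z])%Z ->
    (m = p %[mod n%:Z])%Z -> (z != p %[mod n%:Z])%Z -> k < l -> l < m ->
    t z k -> t l z -> t z m -> False.
  move=> kp lp mp zp.
  apply: (tournament_class_convex (no_positive_relation_flip t_npr));
    by rewrite ?kp ?lp ?mp.
have flip k z : (k = p %[mod n%:Z])%Z -> (z != p %[mod n%:Z])%Z ->
    ~ t k z -> t z k.
  by move=> kp zp /negP; rewrite t_total ?negbK // kp eq_sym.
(* If [y] is congruent to [x], translating it onto [x] leaves one element that splits the class both
   ways. *)
have [/eqz_modP[m yE]|xy] := boolP (x == y %[mod n%:Z])%Z.
  rewrite {}yE in yp typ tqy.
  move: typ tqy; rewrite -(shift_invariant t_inv (- m)).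
  rewrite -(shift_invariant t_inv (- m) q').
  rewrite (_ : x + m * n + - m * n = x); last lia.
  have : p' + - m * n%:Z < q' + - m * n%:Z by rewrite ltrD2r.
  have : (p' + - m * n%:Z = p %[mod n%:Z])%Z by rewrite addrC modzMDl.
  have : (q' + - m * n%:Z = p %[mod n%:Z])%Z by rewrite addrC modzMDl.
  move: (p' + _) (q' + _) => {pp qq pq'} {}p' {}q' qq pp pq' txp tqx.
  have [lt_qq|lt_qq|eq_qq] := ltgtP q q'.
  - exact: (convex1 p q q' x).
  - exact: (convex2 p' q' q x).
  - by apply: (asym q x); rewrite ?qp 1?eq_sym // eq_qq.
have trans k : (k = p %[mod n%:Z])%Z -> t k x -> t x y -> t k y.
  by move=> kp; apply: tournament_trans => //; rewrite kp eq_sym.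
have trans' k : (k = p %[mod n%:Z])%Z -> t k y -> t y x -> t k x.
  by move=> kp; apply: tournament_trans => //; rewrite ?kp 1?eq_sym.
(* If [y] precedes [x], the contradiction arises at the larger of [q] and [q']; if [x] precedes [y],
   at the smaller of [p] and [p']. *)
have [txy|] := boolP (t x y); last first.
  rewrite t_total // negbK => tyx.
  have [le_qq|lt_qq] := leP q q'.
    apply: (asym q' x); rewrite ?qq 1?eq_sym //; first exact: trans'.
    move: le_qq; rewrite le_eqVlt => /orP[/eqP <- //|lt_qq].
    by apply: flip => // tqx; exact: (convex1 p q q' x).
  apply: (asym q x); rewrite ?qp 1?eq_sym //; apply: trans' => //.
  have [//|ntqy] := boolP (t q y).
  by exfalso; apply: (convex2 p' q' q y) => //; apply: flip => //; exact/negP.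
have [le_pp|lt_pp] := leP p p'.
  apply: (asym p y); rewrite 1?eq_sym //; first exact: trans.
  move: le_pp; rewrite le_eqVlt => /orP[/eqP -> //|lt_pp].
  by apply: flip => // tpy; exact: (convex1 p p' q' y).
apply: (asym p' y); rewrite ?pp 1?eq_sym //; apply: trans => //.
have [//|ntpx] := boolP (t p' x).
by exfalso; apply: (convex2 p' p q x) => //; apply: flip => //; exact/negP.
Qed.

Definition descending_class (k : int) := exists p q x : int,
  [/\ (p = k %[mod n%:Z])%Z, (q = k %[mod n%:Z])%Z, (x != k %[mod n%:Z])%Z
    & [/\ p < q, t q x & t x p]].

Definition tournament_order : rel int := fun i j =>
  if (i == j %[mod n%:Z])%Z then
    if `[< descending_class i >] then j < i else i < j
  else t i j.

Lemma tournament_orderE (i j : int) : (i != j %[mod n%:Z])%Z ->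
  tournament_order i j = t i j.
Proof. by rewrite /tournament_order => /negPf ->. Qed.

Lemma descending_class_mod (i j : int) : (i = j %[mod n%:Z])%Z ->
  descending_class i -> descending_class j.
Proof.
by move=> ij [p [q [x [pi qi xi H]]]]; exists p, q, x; rewrite -ij.
Qed.

(** The middle element [j] itself separates the class and so decides its orientation: if [k < i], it
    is a descending witness; if [i < k], it is incompatible with one. *)
Lemma tournament_order_trans_through (i j k : int) :
    (i = k %[mod n%:Z])%Z -> (j != k %[mod n%:Z])%Z ->
  t i j -> t j k -> tournament_order i k.
Proof.
move=> ik jk tij tjk; rewrite /tournament_order ik eqxx.
case: asboolP => [[p [q [x [pi qi xi [lt_pq tqx txp]]]]]|ndesc].
  have [//|lt_ik|eq_ik] := ltgtP k i; exfalso.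
    apply: (@tournament_class_oriented i k p q j x) => //; rewrite ?ik //.
  by move: tij; rewrite -eq_ik t_total 1?eq_sym // tjk.
have [//|lt_ki|eq_ik] := ltgtP i k; exfalso.
  by apply: ndesc; exists k, i, j; split; rewrite ?ik.
by move: tij; rewrite eq_ik t_total 1?eq_sym // tjk.
Qed.

Lemma tournament_order_invariant : invariant_orders n tournament_order.
Proof.
have asym_class i j : (i = j %[mod n%:Z])%Z ->
    tournament_order i j -> tournament_order j i -> False.
  move=> ij; rewrite /tournament_order ij eqxx.
  have -> : `[< descending_class i >] = `[< descending_class j >].
    by apply: asbool_equiv_eq; split; apply: descending_class_mod.
  by case: ifP => _ /lt_trans h /h; rewrite ltxx.
split; first split.
- by move=> i; rewrite /tournament_order eqxx ltxx if_same.
- move=> j i k.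
  (* Cases according to which pairs are congruent. If exactly one of the pairs [i, j] and [j, k] is,
     then [t k i] would order that pair the other way, through the element outside its class. *)
  have [ij|ij] := eqVneq (i %% n)%Z (j %% n)%Z; last first.
    rewrite tournament_orderE //.
    have [jk|jk] := eqVneq (j %% n)%Z (k %% n)%Z; last first.
      rewrite tournament_orderE //.
      have [ik|ik] := eqVneq (i %% n)%Z (k %% n)%Z.
        exact: tournament_order_trans_through.
      rewrite tournament_orderE //; exact: tournament_trans.
    move=> tij ojk; have ik : (i != k %[mod n%:Z])%Z by rewrite -jk.
    rewrite tournament_orderE // t_total //; apply/negP => tki.
    apply: (asym_class j k jk ojk).
    exact: tournament_order_trans_through tki tij.
  have [jk|jk] := eqVneq (j %% n)%Z (k %% n)%Z; last first.
    rewrite (tournament_orderE jk) => oij tjk.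
    have ik : (i != k %[mod n%:Z])%Z by rewrite ij.
    rewrite tournament_orderE // t_total //; apply/negP => tki.
    apply: (asym_class i j ij oij).
    by apply: tournament_order_trans_through tjk tki; rewrite // ij eq_sym.
  rewrite /tournament_order ij jk eqxx.
  have -> : `[< descending_class i >] = `[< descending_class j >].
    by apply: asbool_equiv_eq; split; apply: descending_class_mod.
  by case: ifP => _; [move=> /[swap] | ]; exact: lt_trans.
- move=> i j neq_ij; have [ij|ij] := eqVneq (i %% n)%Z (j %% n)%Z; last first.
    rewrite !tournament_orderE //; last by rewrite eq_sym.
    by rewrite (t_total ij) orNb.
  rewrite /tournament_order ij eqxx.
  have -> : `[< descending_class i >] = `[< descending_class j >].
    by apply: asbool_equiv_eq; split; apply: descending_class_mod.
  by case: ifP => _; rewrite -neq_lt // eq_sym.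
move=> i j; rewrite /tournament_order !modzDr -t_inv !ltrD2r.
have -> // : `[< descending_class i >] = `[< descending_class (i + n%:Z) >].
by apply: asbool_equiv_eq; split; apply: descending_class_mod; rewrite modzDr.
Qed.

End TournamentToOrder.

Lemma biclosed_inversions (B : set (Vhat R n)) : (0 < n)%N -> biclosed B ->
  exists2 lt, invariant_orders n lt & B = inversions R n lt.
Proof.
move=> n_gt0 /biclosed_tournament[t [t_inv t_total t_npr ->]].
exists (tournament_order t); first exact: tournament_order_invariant.
by apply/seteqP; split=> v [i [j [lt_ij ij tji ->]]]; exists i, j; split=> //;
  move: tji; rewrite tournament_orderE 1?eq_sym.
Qed.

End Descents.

(** * The classification and the induced bijection *)

Theorem theorem2p3 (R : realType) (n : nat) (n_ge1 : (1 <= n)%N) :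
  [/\ forall lt : rel int, invariant_orders n lt ->
        biclosed (inversions R n lt),
      forall B : set (Vhat R n), biclosed B ->
        exists2 lt : rel int, invariant_orders n lt & B = inversions R n lt,
      forall lt1 lt2 : rel int,
        invariant_orders n lt1 -> invariant_orders n lt2 ->
        (inversions R n lt1 = inversions R n lt2 <->
         interval_reversal n lt1 lt2)
    & exists2 f : set (rel int) -> set (Vhat R n),
        set_bij (invariant_orders_modulo n) [set B | biclosed B] f
      & forall (C : set (rel int)) (lt : rel int),
          invariant_orders_modulo n C -> C lt -> f C = inversions R n lt].
Proof.
have bicl lt := @inversions_biclosed R n lt n_ge1.
have surj B := @biclosed_inversions R n B n_ge1.
have eqI lt1 lt2 := @eq_inversions_reversal R n lt1 lt2 n_ge1.
split=> //.
pose class lt :=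
  [set lt' | invariant_orders n lt' /\ interval_reversal n lt lt'].
have class_refl lt : invariant_orders n lt -> class lt lt.
  by move=> ord; split=> //; apply/eqI.
(* The union over [C] avoids choosing a representative; all members of one class have the same
   inversion set. *)
pose f (C : set (rel int)) := [set v | exists2 lt, C lt & inversions R n lt v].
have fE lt : invariant_orders n lt -> f (class lt) = inversions R n lt.
  move=> ord; apply/seteqP; split=> [v [lt' [ord' /eqI <- //]]|v Iv].
  by exists lt => //; exact: class_refl.
exists f; last first.
  by move=> _ lt' [lt ord ->] [ord' rev]; rewrite fE //; apply/eqI.
split=> [_ [lt ord ->] | | B /surj[lt ord ->]].
- by rewrite /= fE //; exact: bicl.
- move=> _ _ /set_mem[lt1 ord1 ->] /set_mem[lt2 ord2 ->].
  rewrite !fE // => eqI12; apply/seteqP.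
  by split=> lt' [ord' /eqI E]; split=> //; apply/eqI => //; rewrite -E.
- by exists (class lt); [exists lt | exact: fE].
Qed.
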